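(* Let $p\in[1,2]$. There is a randomized algorithm (the Hutch++ estimator, with rank parameter chosen appropriately) which, given matrix-vector multiplication query access to any real square matrix ${\bm{A}}$ and parameters $\varepsilon,\delta\in(0,1)$, outputs an estimate $\texttt{Hutch++}({\bm{A}})$ satisfying $$|\operatorname{tr}({\bm{A}})-\texttt{Hutch++}({\bm{A}})|\le\varepsilon\|{\bm{A}}\|_p$$ with probability at least $1-\delta$, using a total of $$O\!\left(\left(\frac{\sqrt{\log(1/\delta)}}{\varepsilon}\right)^p+\log(1/\delta)\right)$$ matrix-vector multiplication queries.
   Context: $\|{\bm{A}}\|_p=(\sum_i\sigma_i^p)^{1/p}$ is the Schatten-$p$ norm, $\sigma_i$ being the singular values of ${\bm{A}}$. The algorithm accesses ${\bm{A}}$ only through products ${\bm{A}}x$ for vectors $x$ of its choice. (Hutch++ computes a low-rank approximation of ${\bm{A}}$ from matrix-vector products, computes its trace exactly, and applies Hutchinson's random-vector estimator $\frac1\ell\sum_j g_j^\top(\cdot)g_j$ to the residual.)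
   Formalization: In the query bound, log(1/δ) is replaced by log(1/min(δ,1/2)), since as δ→1 the literal bound drops below one query and no query-free estimate can work; the random vectors are taken with independent uniform ±1 entries. *)

(* Defs.v *)
From mathcomp Require Import all_boot all_order all_algebra.
From mathcomp Require Import complex.
From mathcomp Require Import classical_sets reals exp.

Set Implicit Arguments.
Unset Strict Implicit.
Unset Printing Implicit Defensive.

Import Order.TTheory GRing.Theory Num.Theory.
Local Open Scope ring_scope.

Section SchattenNorm.
Variable R : realType.

(* [s] lists the eigenvalues of [M], with multiplicity. *)
Definition is_spectrum n (M : 'M[R]_n) (s : seq R) : Prop :=
  char_poly M = \prod_(x <- s) ('X - x%:P).

Definition singular_values n (A : 'M[R]_n) : seq R :=
  [seq Num.sqrt x | x <- xget [::] (is_spectrum (A^T *m A) : set (seq R))].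

Definition schatten_norm n (p : R) (A : 'M[R]_n) : R :=
  (\sum_(x <- singular_values A) x `^ p) `^ p^-1.

Lemma gram_spectrumP n (A : 'M[R]_n) :
  exists2 s : seq R, is_spectrum (A^T *m A) s & all (fun x => 0 <= x) s.
Proof.
pose f : {rmorphism R -> R[i]} := real_complex R.
pose M := A^T *m A.
have [r Er] := closed_field_poly_normal (char_poly (map_mx f M)).
rewrite (monicP (char_poly_monic _)) scale1r in Er.
have r_ge0 z : z \in r -> 0 <= z.
  move=> zr.
  have : root (char_poly (map_mx f M)) z by rewrite Er root_prod_XsubC.
  rewrite -eigenvalue_root_char => /eigenvalueP[v Ev vN0].
  pose h m (u : 'rV[R[i]]_m) := \sum_j u 0 j * (u 0 j)^*%C.
  have hge0 m (u : 'rV_m) j : 0 <= u 0 j * (u 0 j)^*%C.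
    by rewrite -sqr_normc exprn_ge0.
  have hv0 : 0 < h _ v.
    rewrite lt_neqAle sumr_ge0 ?andbT; last by move=> j _; apply: hge0.
    rewrite eq_sym psumr_eq0; last by move=> j _; apply: hge0.
    apply: contraNN vN0 => /allP v0; apply/eqP/rowP => j; rewrite mxE.
    have := v0 j (mem_index_enum j).
    by rewrite -sqr_normc sqrf_eq0 normr_eq0 => /eqP.
  pose c m k (B : 'M[R[i]]_(m, k)) := map_mx (@conjc R) B.
  have hE m (u : 'rV_m) : h m u = (u *m (c _ _ u)^T) 0 0.
    by rewrite mxE; apply: eq_bigr => j _; rewrite !mxE.
  have key : z * h _ v = h _ (v *m map_mx f A^T).
    pose B := map_mx f A^T.
    have BB : B *m B^T = map_mx f M by rewrite map_trmx trmxK -map_mxM.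
    have cB : c _ _ (v *m B) = c _ _ v *m B.
      rewrite /c map_mxM; congr (_ *m _).
      by apply/matrixP => i j; rewrite !mxE /= oppr0.
    rewrite !hE -/B cB trmx_mul mulmxA -(mulmxA v) BB Ev.
    by rewrite -scalemxAl [RHS]mxE.
  have : 0 <= z * h _ v by rewrite key sumr_ge0 // => j _; apply: hge0.
  by rewrite pmulr_lge0.
exists [seq complex.Re z | z <- r].
- rewrite /is_spectrum; apply: (map_poly_inj f).
  rewrite map_char_poly Er rmorph_prod big_map /= big_seq [RHS]big_seq.
  apply: eq_bigr => z /r_ge0; rewrite rmorphB /= map_polyX map_polyC /=.
  by case: z => a b; rewrite lecE /= => /andP[/eqP-> _].
- apply/allP => x /mapP[z /r_ge0]; case: z => a b.
  by rewrite lecE /= => /andP[_ a_ge0] ->.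
Qed.

Lemma singular_valuesP n (A : 'M[R]_n) :
  is_spectrum (A^T *m A) [seq x ^+ 2 | x <- singular_values A].
Proof.
have [s sP /allP s_ge0] := gram_spectrumP A.
rewrite /singular_values; case: xgetP => [t _ tP|/(_ s)//].
rewrite /is_spectrum -map_comp big_map tP big_seq [RHS]big_seq.
apply: eq_bigr => x xt; rewrite /= sqr_sqrtr // s_ge0 //.
by rewrite -root_prod_XsubC -sP tP root_prod_XsubC.
Qed.

End SchattenNorm.

(* Adaptive algorithms whose only access to the input matrix is through answers
   [A *m x] to queries [x]: the matrix itself is not an argument. *)
Inductive mv_alg (R : realType) (n : nat) : Type :=
| Output of R
| Query of 'cV[R]_n & ('cV[R]_n -> mv_alg R n).

Arguments Output {R n}.
Arguments Query {R n}.

Section QueryModel.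
Variables (R : realType) (n : nat).

Fixpoint run (A : 'M[R]_n) (a : mv_alg R n) : R :=
  match a with
  | Output r => r
  | Query x a' => run A (a' (A *m x))
  end.

Fixpoint nqueries (A : 'M[R]_n) (a : mv_alg R n) : nat :=
  match a with
  | Output _ => 0
  | Query x a' => (nqueries A (a' (A *m x))).+1
  end.

Fixpoint query_all (xs : seq 'cV[R]_n) (a : seq 'cV[R]_n -> mv_alg R n) :=
  match xs with
  | [::] => a [::]
  | x :: xs' => Query x (fun y => query_all xs' (fun ys => a (y :: ys)))
  end.

End QueryModel.

Section HutchPP.
Variables (R : realType) (n : nat).
Implicit Types (u v : 'cV[R]_n) (Q : seq 'cV[R]_n).

Definition dotv u v : R := \sum_i u i 0 * v i 0.

(* For orthonormal [Q], this is [(I - Q Q^T) v]. *)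
Definition deflate Q v : 'cV[R]_n := v - \sum_(q <- Q) dotv q v *: q.

Definition gram_schmidt_step Q v : seq 'cV[R]_n :=
  let w := deflate Q v in
  if w == 0 then Q else rcons Q ((Num.sqrt (dotv w w))^-1 *: w).

Definition gram_schmidt (vs : seq 'cV[R]_n) : seq 'cV[R]_n :=
  foldl gram_schmidt_step [::] vs.

(* Returns tr(Q^T A Q) + tr(G^T (I - Q Q^T) A (I - Q Q^T) G) / l, where Q is an
   orthonormal basis of the column span of A S and l is the number of columns
   of G. *)
Definition hutchpp_alg (S G : seq 'cV[R]_n) : mv_alg R n :=
  query_all S (fun AS =>
  let Q := gram_schmidt AS in
  query_all Q (fun AQ =>
  let H := [seq deflate Q g | g <- G] in
  query_all H (fun AH =>
  Output (\sum_(z <- zip Q AQ) dotv z.1 z.2 +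
          (size G)%:R^-1 * \sum_(z <- zip H AH) dotv z.1 z.2)))).

Definition sign_cols k (B : 'M[bool]_(n, k)) : seq 'cV[R]_n :=
  [seq \col_i (-1) ^+ (B i j) | j <- enum 'I_k].

(* Sign patterns of the sketching matrix S (k columns) and of the Hutchinson
   vectors G (l columns); uniform seeds make all entries i.i.d. Rademacher. *)
Definition seed (k l : nat) : finType := ('M[bool]_(n, k) * 'M[bool]_(n, l))%type.

Definition hutchpp k l (w : seed k l) : mv_alg R n :=
  hutchpp_alg (sign_cols w.1) (sign_cols w.2).

End HutchPP.

Arguments hutchpp {R n k l}.

Definition uniform_prob (R : realType) (T : finType) (E : pred T) : R :=
  #|E|%:R / #|T|%:R.

(* Main.v *)
(** Gram-Schmidt on [A S] inserts one column [A s] at a time.  If [P] is the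
    current residual projection and [M = A^T P A], inserting [A s] decreases
    [t = |P A|_F^2] by [|M s|^2 / |P A s|^2], which with constant conditional
    probability is at least a constant times [|M|_F^2 / t].  The diagonal [m] of
    [M] in a right singular basis of [A] satisfies [m_i <= sigma_i^2], whence
    [t <= tau^(1 - p/2) |A|_p^p + |M|_F^2 / tau] for all [tau > 0], and so
    [|M|_F^2 / t] is at least a constant times [(t / 2|A|_p^p)^(2/(2-p))].  Hence
    [t^(-p/(2-p))] grows by a constant at a constant fraction of the columns, and
    [t] decays like [k^(1-2/p) |A|_p^2], with exponentially small failure
    probability.

    The remaining error is that of Hutchinson's estimator for [P A P], controlled
    by a Hanson-Wright bound on exponential moments of Rademacher quadratic
    forms, which also gives the constant-probability estimates above. *)

Require Import Defs.
From mathcomp Require Import all_boot all_order all_algebra.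
From mathcomp Require Import sesquilinear spectral complex.
From mathcomp Require Import classical_sets reals sequences exp.
From mathcomp Require Import ring lra.

Set Implicit Arguments.
Unset Strict Implicit.
Unset Printing Implicit Defensive.

Import Order.TTheory GRing.Theory Num.Theory.
Local Open Scope ring_scope.

(** * Uniform means and the Frobenius norm *)

Section Mean.
Variable R : realType.

Definition mean (T : finType) (f : T -> R) : R := (\sum_t f t) / #|T|%:R.

Lemma eq_mean (T : finType) (f g : T -> R) : f =1 g -> mean f = mean g.
Proof. by move=> fg; rewrite /mean (eq_bigr g). Qed.

Lemma le_mean (T : finType) (f g : T -> R) :
  (forall t, f t <= g t) -> mean f <= mean g.
Proof. by move=> fg; rewrite ler_wpM2r ?invr_ge0 ?ler0n// ler_sum. Qed.

Lemma meanZ (T : finType) (c : R) (f : T -> R) :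
  mean (fun t => c * f t) = c * mean f.
Proof. by rewrite /mean -mulr_sumr mulrA. Qed.

Lemma meanD (T : finType) (f g : T -> R) :
  mean (fun t => f t + g t) = mean f + mean g.
Proof. by rewrite /mean big_split mulrDl. Qed.

Lemma mean_cst (T : finType) (c : R) : (0 < #|T|)%N -> mean (fun _ : T => c) = c.
Proof.
by move=> T0; rewrite /mean sumr_const -[c *+ _]mulr_natr mulfK// pnatr_eq0 -lt0n.
Qed.

Lemma mean_ge0 (T : finType) (f : T -> R) : (forall t, 0 <= f t) -> 0 <= mean f.
Proof. by move=> f0; rewrite divr_ge0 ?ler0n// sumr_ge0. Qed.

Lemma mean_bij (T U : finType) (h : T -> U) (f : U -> R) :
  bijective h -> mean f = mean (f \o h).
Proof.
by move=> bh; rewrite /mean (bij_eq_card bh) (reindex h)//; exact: onW_bij.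
Qed.

Lemma mean_pair (T U : finType) (f : T * U -> R) :
  mean f = mean (fun t => mean (fun u => f (t, u))).
Proof.
rewrite /mean card_prod -mulr_suml -mulrA natrM invfM [_^-1 * _]mulrC.
by rewrite pair_bigA; congr (_ * _); apply: eq_bigr => -[].
Qed.

Lemma mean_bool (f : bool -> R) : mean f = (f true + f false) / 2.
Proof. by rewrite /mean card_bool big_bool. Qed.

Lemma uniform_prob_mean (T : finType) (E : pred T) :
  uniform_prob R E = mean (fun t => (E t)%:R).
Proof.
rewrite /uniform_prob /mean -natr_sum -sum1_card big_mkcond.
by congr (_%:R / _); apply: eq_bigr => t _; rewrite unfold_in; case: (E t).
Qed.

End Mean.

Lemma card_sign_gt0 m n : (0 < #|{: 'M[bool]_(m, n)}|)%N.
Proof. by rewrite card_mx card_bool expn_gt0. Qed.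

Lemma mean_col_recl (R : realType) n (f : 'cV[bool]_n.+1 -> R) :
  mean f = mean (fun b : 'cV[bool]_n =>
    (f (col_mx (const_mx true : 'M_1) b) +
     f (col_mx (const_mx false : 'M_1) b)) / 2).
Proof.
pose h (x : 'cV[bool]_n * bool) : 'cV[bool]_n.+1 :=
  col_mx (const_mx x.2 : 'M_1) x.1.
have bh : bijective h.
  exists (fun B : 'cV[bool]_(1 + n) => (dsubmx B, B 0 0)) => [[b c]|B].
    rewrite /h /= col_mxKd; congr (_, _).
    have -> : 0 = lshift n (0 : 'I_1) :> 'I_(1 + n) by apply: val_inj.
    by rewrite col_mxEu mxE.
  rewrite /h /=; apply: etrans (vsubmxK (B : 'M_(1 + n, 1))); congr col_mx.
  apply/matrixP => i j; rewrite !mxE !ord1; congr (B _ _).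
  by apply: val_inj.
rewrite (mean_bij _ bh) mean_pair; apply: eq_mean => b.
by rewrite mean_bool.
Qed.

Lemma mean_row_recl (R : realType) n k (f : 'M[bool]_(n, k.+1) -> R) :
  mean f = mean (fun b : 'cV[bool]_n => mean (fun B : 'M[bool]_(n, k) =>
    f (row_mx b B))).
Proof.
pose h (x : 'cV[bool]_n * 'M[bool]_(n, k)) : 'M[bool]_(n, k.+1) :=
  row_mx x.1 x.2.
have bh : bijective h.
  exists (fun B : 'M[bool]_(n, 1 + k) => (lsubmx B, rsubmx B)) => [[b c]|B].
    by rewrite /h /= row_mxKl row_mxKr.
  exact: hsubmxK.
by rewrite (mean_bij _ bh) mean_pair.
Qed.

Section FrobeniusNorm.
Variable R : realType.

Lemma Cauchy_Schwarz_sum (I : finType) (a b : I -> R) :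
  (\sum_i a i * b i) ^+ 2 <= (\sum_i a i ^+ 2) * (\sum_i b i ^+ 2).
Proof.
have -> : (\sum_i a i * b i) ^+ 2 = \sum_i \sum_j (a i * b i) * (a j * b j).
  by rewrite expr2 mulr_suml; apply: eq_bigr => i _; rewrite mulr_sumr.
have -> : (\sum_i a i ^+ 2) * (\sum_i b i ^+ 2) =
    \sum_i \sum_j a i ^+ 2 * b j ^+ 2.
  by rewrite mulr_suml; apply: eq_bigr => i _; rewrite mulr_sumr.
(* Lagrange's identity: twice the difference is the sum of the squares
   [(a i * b j - a j * b i) ^+ 2]. *)
rewrite -subr_ge0 -(pmulr_rge0 _ (ltr0Sn _ 1)) mulr_natl mulr2n.
rewrite {1}[X in (X - _) + _]exchange_big -!sumrB -big_split /=.
apply: sumr_ge0 => i _; rewrite -!sumrB -big_split /=; apply: sumr_ge0 => j _.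
by have := sqr_ge0 (a i * b j - a j * b i); lra.
Qed.

Definition frob2 m n (M : 'M[R]_(m, n)) : R := \sum_i \sum_j M i j ^+ 2.

Lemma frob2_ge0 m n (M : 'M[R]_(m, n)) : 0 <= frob2 M.
Proof. by apply: sumr_ge0 => i _; apply: sumr_ge0 => j _; exact: sqr_ge0. Qed.

Lemma frob2E m n (M : 'M[R]_(m, n)) : frob2 M = \tr (M^T *m M).
Proof.
rewrite /frob2 exchange_big; apply: eq_bigr => j _.
by rewrite mxE; apply: eq_bigr => i _; rewrite mxE.
Qed.

Lemma frob2_tr m n (M : 'M[R]_(m, n)) : frob2 M^T = frob2 M.
Proof.
by rewrite /frob2 exchange_big; do 2 ![apply: eq_bigr => ? _]; rewrite mxE.
Qed.

Lemma frob2Z m n c (M : 'M[R]_(m, n)) : frob2 (c *: M) = c ^+ 2 * frob2 M.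
Proof.
rewrite /frob2 mulr_sumr; apply: eq_bigr => i _; rewrite mulr_sumr.
by apply: eq_bigr => j _; rewrite mxE exprMn.
Qed.

Lemma frob2_eq0 m n (M : 'M[R]_(m, n)) : frob2 M = 0 -> M = 0.
Proof.
move=> /eqP; rewrite psumr_eq0 => [/allP M0|i _]; last first.
  by apply: sumr_ge0 => j _; exact: sqr_ge0.
apply/matrixP => i j; rewrite mxE.
have := M0 i (mem_index_enum _); rewrite psumr_eq0 => [/allP|? _]; last first.
  exact: sqr_ge0.
by move=> /(_ j (mem_index_enum _)); rewrite sqrf_eq0 => /eqP.
Qed.

(** Entries of [M^T *m M] are inner products of columns of [M]. Cauchy-Schwarz bounds each square by
    a product of squared column norms, and these products sum to [frob2 M ^+ 2]. *)
Lemma frob2_gram_le m n (M : 'M[R]_(m, n)) : frob2 (M^T *m M) <= frob2 M ^+ 2.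
Proof.
rewrite -(frob2_tr M) /frob2 [leRHS]expr2 mulr_suml; apply: ler_sum => i _.
rewrite mulr_sumr; apply: ler_sum => j _; rewrite mxE.
apply: le_trans (Cauchy_Schwarz_sum _ _) _; rewrite ler_wpM2l//.
  by apply: sumr_ge0 => ? _; exact: sqr_ge0.
by apply: ler_sum => ? _; rewrite !mxE.
Qed.

Lemma frob2_sym_le n (M : 'M[R]_n) : frob2 (2^-1 *: (M + M^T)) <= frob2 M.
Proof.
have -> : frob2 M = 2^-1 * (frob2 M + frob2 M^T) by rewrite frob2_tr; lra.
rewrite frob2Z /frob2 -big_split !mulr_sumr; apply: ler_sum => i _.
rewrite -big_split !mulr_sumr; apply: ler_sum => j _; rewrite !mxE.
have -> : 2^-1 ^+ 2 = 4^-1 :> R by field.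
by have := sqr_ge0 (M i j - M j i); rewrite /=; lra.
Qed.

End FrobeniusNorm.

(** * Exponential moments of Rademacher quadratic forms *)

Section RademacherChaos.
Variable R : realType.

(** For [y ^+ 2 <= 1/2], the bounds [expR (+- y) <= 1 / (1 -+ y)] average to
    [1 / (1 - y^2) <= 1 + 2 y^2]. Larger arguments follow by doubling: [cosh y = 2 cosh(y/2)^2 - 1
    <= cosh(y/2)^4], while the right-hand side is exactly raised to the fourth power. *)
Lemma cosh_le (x : R) : (expR x + expR (- x)) / 2 <= expR (2 * x ^+ 2).
Proof.
have small (y : R) : y ^+ 2 <= 2^-1 ->
    (expR y + expR (- y)) / 2 <= expR (2 * y ^+ 2).
  move=> y2; have ltN1 : y ^+ 2 < 1 by lra.
  have /andP[y1 y1'] : -1 < y < 1 by apply/andP; split; nra.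
  have le_inv (z : R) : z < 1 -> expR z <= (1 - z)^-1.
    move=> z1; rewrite -[expR z]invrK -expRN lef_pV2 ?posrE ?expR_gt0 ?subr_gt0//.
    exact: expR_ge1Dx.
  apply: le_trans (expR_ge1Dx _).
  have := le_inv y y1'; have := le_inv (- y); rewrite opprK => /(_ _) h1 h2.
  have {}h1 : expR (- y) <= (1 + y)^-1 by apply: h1; lra.
  have h3 : (1 - y)^-1 + (1 + y)^-1 = 2 / (1 - y ^+ 2).
    by field; rewrite !gt_eqF//; lra.
  have h4 : (1 - y ^+ 2)^-1 <= 1 + 2 * y ^+ 2.
    rewrite -[leRHS]mulr1 -ler_pdivrMl; last by have := sqr_ge0 y; lra.
    rewrite -invfM invf_le1; first by have := sqr_ge0 y; nra.
    by have := sqr_ge0 y; nra.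
  by lra.
have step (y : R) :
    (expR (y / 2) + expR (- (y / 2))) / 2 <= expR (2 * (y / 2) ^+ 2) ->
    (expR y + expR (- y)) / 2 <= expR (2 * y ^+ 2).
  set u := expR (y / 2); set v := expR _ => uv.
  have -> : expR y = u ^+ 2 by rewrite -expRM_natl; congr expR; field.
  have -> : expR (- y) = v ^+ 2 by rewrite -expRM_natl; congr expR; field.
  have -> : 2 * y ^+ 2 = 4%:R * (2 * (y / 2) ^+ 2) by field.
  rewrite expRM_natl; set c := (u + v) / 2 in uv *.
  have c0 : 0 <= c by rewrite divr_ge0// addr_ge0// expR_ge0.
  have uv1 : u * v = 1 by rewrite -expRD subrr expR0.
  apply: le_trans (lerXn2r 4 _ _ uv); rewrite ?nnegrE ?expR_ge0//.
  have -> : (u ^+ 2 + v ^+ 2) / 2 = 2 * c ^+ 2 - u * v by rewrite /c; field.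
  rewrite uv1.
  by have := sqr_ge0 (c ^+ 2 - 1); lra.
suff : forall k (y : R), y ^+ 2 <= 2^-1 * 4 ^+ k ->
    (expR y + expR (- y)) / 2 <= expR (2 * y ^+ 2).
  set N := Num.bound (x ^+ 2); move=> /(_ N.+1); apply; apply: ltW.
  have := @upper_nthrootP _ (x ^+ 2) N (leqnn _).
  have : (2 : R) ^+ N <= 4 ^+ N by rewrite lerXn2r ?nnegrE//; lra.
  by have := exprn_ge0 N (ler0n R 4); rewrite [4 ^+ N.+1]exprS; lra.
elim=> [y|k IH y y2]; first by rewrite mulr1; exact: small.
by apply/step/IH; rewrite exprMn; move: y2; rewrite [4 ^+ k.+1]exprS; lra.
Qed.

Definition sgnv n (b : 'cV[bool]_n) : 'cV[R]_n := \col_i (-1) ^+ b i 0.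

Definition quad n (M : 'M[R]_n) (v : 'cV[R]_n) : R :=
  \sum_i \sum_j M i j * v i 0 * v j 0.

Lemma sgnv_col_mx0 n (b : 'cV[bool]_n) c :
  sgnv (col_mx (const_mx c : 'M_1) b) 0 0 = (-1) ^+ c.
Proof.
rewrite mxE; have -> : 0 = lshift n (0 : 'I_1) :> 'I_(1 + n) by apply: val_inj.
by rewrite col_mxEu mxE.
Qed.

Lemma sgnv_col_mx_lift n (b : 'cV[bool]_n) c i :
  sgnv (col_mx (const_mx c : 'M_1) b) (lift 0 i) 0 = sgnv b i 0.
Proof.
rewrite [LHS]mxE [RHS]mxE.
have -> : lift 0 i = rshift 1 i :> 'I_(1 + n) by apply: val_inj.
by rewrite col_mxEd.
Qed.

Lemma quad_sgnv_recl n (M : 'M[R]_n.+1) (b : 'cV[bool]_n) c : M^T = M ->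
  quad M (sgnv (col_mx (const_mx c : 'M_1) b)) =
  M 0 0 + (-1) ^+ c * (2 * \sum_i M 0 (lift 0 i) * sgnv b i 0) +
  quad (\matrix_(i, j) M (lift 0 i) (lift 0 j)) (sgnv b).
Proof.
move=> Msym; rewrite /quad big_ord_recl big_ord_recl sgnv_col_mx0.
have -> : M 0 0 * (-1) ^+ c * (-1) ^+ c = M 0 0.
  by rewrite -mulrA -signr_addb addbb mulr1.
rewrite -!addrA; congr (_ + _).
under eq_bigr do rewrite sgnv_col_mx_lift.
under [X in _ + X = _]eq_bigr do rewrite big_ord_recl sgnv_col_mx0 sgnv_col_mx_lift.
rewrite big_split /= !addrA; congr (_ + _).
  have -> : \sum_(i < n) M (lift ord0 i) ord0 * sgnv b i 0 * (-1) ^+ c =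
      \sum_(i < n) M 0 (lift 0 i) * (-1) ^+ c * sgnv b i 0.
    by apply: eq_bigr => i _; rewrite -[in LHS]Msym mxE mulrAC.
  rewrite -mulr2n -[LHS]mulr_natl [RHS]mulrCA; congr (_ * _); rewrite mulr_sumr.
  by apply: eq_bigr => i _; rewrite mulrCA mulrA.
apply: eq_bigr => i _; apply: eq_bigr => j _.
by rewrite sgnv_col_mx_lift [in RHS]mxE.
Qed.

Lemma frob2_recl n (M : 'M[R]_n.+1) : M^T = M ->
  frob2 M = M 0 0 ^+ 2 + 2 * (\sum_i M 0 (lift 0 i) ^+ 2) +
    frob2 (\matrix_(i, j) M (lift 0 i) (lift 0 j)).
Proof.
move=> Msym; rewrite /frob2 big_ord_recl big_ord_recl.
under [X in _ + X = _]eq_bigr do rewrite big_ord_recl.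
rewrite big_split /= mulr_natl mulr2n !addrA; congr (_ + _ + _).
  by apply: eq_bigr => i _; rewrite -[in LHS]Msym mxE.
by apply: eq_bigr => i _; apply: eq_bigr => j _; rewrite mxE.
Qed.

(* Averaging over the first sign turns the off-diagonal part [m] of the first
   row into the rank-one term [8 m^T m], since [cosh (2 x) <= exp (8 x^2)]; for
   a small enough matrix this decreases the Frobenius norm. *)
Lemma Hanson_Wright_sym n (M : 'M[R]_n) : M^T = M -> frob2 M <= 1024^-1 ->
  mean (fun b : 'cV[bool]_n => expR (quad M (sgnv b))) <=
    expR (\tr M + 8 * frob2 M).
Proof.
elim: n M => [|n IH] M Msym M_le.
  rewrite (@eq_mean _ _ _ (fun=> 1)) => [|b]; last by rewrite /quad big_ord0 expR0.
  rewrite mean_cst ?card_sign_gt0//; apply: le_trans (expR_ge1Dx _).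
  by rewrite /mxtrace big_ord0 add0r lerDl mulr_ge0 ?frob2_ge0 ?ler0n.
have FM := frob2_recl Msym; move: FM.
set m := fun i => M 0 (lift 0 i); set M' := \matrix_(i, j) _.
set m2 := \sum_i _ => FM.
have m2_ge0 : 0 <= m2 by apply: sumr_ge0 => i _; exact: sqr_ge0.
have M'_ge0 := frob2_ge0 M'.
pose N : 'M[R]_n := \matrix_(i, j) (M' i j + 8 * (m i * m j)).
have Nsym : N^T = N.
  apply/matrixP => i j; rewrite !mxE [m j * _]mulrC; congr (_ + _).
  by rewrite -[in LHS]Msym mxE.
have trM : \tr M = M 0 0 + \tr M'.
  by rewrite /mxtrace big_ord_recl; congr (_ + _); apply: eq_bigr => i _; rewrite mxE.
have trN : \tr N = \tr M' + 8 * m2.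
  rewrite /mxtrace mulr_sumr -big_split /=; apply: eq_bigr => i _.
  by rewrite [in LHS]mxE expr2.
pose X := \sum_i \sum_j M' i j * (m i * m j).
have m4 : m2 ^+ 2 = \sum_i \sum_j (m i * m j) ^+ 2.
  rewrite expr2 mulr_suml; apply: eq_bigr => i _; rewrite mulr_sumr.
  by apply: eq_bigr => j _; rewrite exprMn.
have FN : frob2 N = frob2 M' + 16 * X + 64 * m2 ^+ 2.
  rewrite m4 /frob2 !mulr_sumr -!big_split /=; apply: eq_bigr => i _.
  rewrite !mulr_sumr -!big_split /=; apply: eq_bigr => j _.
  by rewrite [in LHS]mxE; ring.
have X2 : X ^+ 2 <= frob2 M' * m2 ^+ 2.
  have := Cauchy_Schwarz_sum (fun x : 'I_n * 'I_n => M' x.1 x.2)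
    (fun x => m x.1 * m x.2).
  by rewrite m4 /X /frob2 !pair_bigA.
(* Otherwise [X ^+ 2] would exceed [m2 ^+ 2 / 1024], against [X2] and [frob2 M' <= 1/1024]; the
   threshold is [32^2]. *)
have X_le : X <= m2 / 32.
  rewrite leNgt; apply/negP => Xgt; by have := sqr_ge0 (M 0 0); nra.
(* The loss of [m2] pays for the rank-one term: the trace grows by [8 * m2], and [8 * frob2] falls
   by at least as much. *)
have FN_le : frob2 N <= frob2 M - m2.
  by rewrite FN FM; have := sqr_ge0 (M 0 0); nra.
rewrite mean_col_recl.
apply: (@le_trans _ _ (expR (M 0 0) *
    mean (fun b : 'cV[bool]_n => expR (quad N (sgnv b))))).
  rewrite -meanZ; apply: le_mean => b; rewrite !quad_sgnv_recl// -/M'.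
  set D := 2 * _; rewrite expr1 expr0 mulN1r mul1r.
  have -> : quad N (sgnv b) = quad M' (sgnv b) + 2 * D ^+ 2.
    have -> : 2 * D ^+ 2 = 8 * (\sum_i m i * sgnv b i 0) ^+ 2.
      by rewrite /D exprMn /m; ring.
    rewrite expr2 mulr_suml mulr_sumr /quad -big_split /=; apply: eq_bigr => i _.
    rewrite mulrA !mulr_sumr -big_split /=; apply: eq_bigr => j _.
    by rewrite [in LHS]mxE; ring.
  have -> : (expR (M 0 0 - D + quad M' (sgnv b)) +
             expR (M 0 0 + D + quad M' (sgnv b))) / 2 =
      expR (M 0 0) * (expR (quad M' (sgnv b)) * ((expR D + expR (- D)) / 2)).
    by rewrite !expRD; ring.
  by rewrite expRD !ler_wpM2l ?expR_ge0// cosh_le.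
apply: le_trans (_ : _ <= expR (M 0 0) * expR (\tr N + 8 * frob2 N)) _.
  by rewrite ler_wpM2l ?expR_ge0// IH//; lra.
by rewrite -expRD ler_expR trM trN; lra.
Qed.

Lemma quad_sym n (M : 'M[R]_n) v : quad (2^-1 *: (M + M^T)) v = quad M v.
Proof.
have -> : quad M v = 2^-1 * (quad M v + quad M^T v).
  have -> : quad M^T v = quad M v; last by lra.
  rewrite /quad exchange_big; apply: eq_bigr => i _; apply: eq_bigr => j _.
  by rewrite mxE mulrAC.
rewrite /quad -big_split /= mulr_sumr; apply: eq_bigr => i _.
rewrite -big_split /= mulr_sumr; apply: eq_bigr => j _.
by rewrite !mxE; ring.
Qed.

Lemma quadZ n c (M : 'M[R]_n) v : quad (c *: M) v = c * quad M v.
Proof.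
rewrite /quad mulr_sumr; apply: eq_bigr => i _; rewrite mulr_sumr.
by apply: eq_bigr => j _; rewrite mxE !mulrA.
Qed.

(** Symmetrizing keeps the quadratic form and the trace and does not increase the Frobenius norm. *)
Lemma Hanson_Wright n (M : 'M[R]_n) c : c ^+ 2 * frob2 M <= 1024^-1 ->
  mean (fun b : 'cV[bool]_n => expR (c * quad M (sgnv b))) <=
    expR (c * \tr M + 8 * (c ^+ 2 * frob2 M)).
Proof.
move=> cM; pose N := c *: (2^-1 *: (M + M^T)).
have FN : frob2 N <= c ^+ 2 * frob2 M.
  by rewrite frob2Z ler_wpM2l ?sqr_ge0// frob2_sym_le.
have Nsym : N^T = N.
  by apply/matrixP => i j; rewrite !mxE [M j i + _]addrC.
have := Hanson_Wright_sym Nsym (le_trans FN cM).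
rewrite (@eq_mean _ _ _ (fun b => expR (c * quad M (sgnv b)))) => [|b]; last first.
  by rewrite quadZ quad_sym.
move/le_trans; apply; rewrite ler_expR lerD ?ler_wpM2l//.
by rewrite /N !mxtraceZ mxtraceD mxtrace_tr; lra.
Qed.

End RademacherChaos.

(** * Residual projections *)

Section Deflation.
Variables (R : realType) (n : nat).
Implicit Types (u v w s : 'cV[R]_n) (Q : seq 'cV[R]_n) (A P : 'M[R]_n).

Lemma dotvE u v : dotv u v = (u^T *m v) 0 0.
Proof. by rewrite /dotv mxE; apply: eq_bigr => i _; rewrite mxE. Qed.

Lemma dotv_tr u v : dotv u v = \tr (v *m u^T).
Proof. by rewrite mxtrace_mulC dotvE /mxtrace big_ord1. Qed.

Lemma dotv_frob2 v : dotv v v = frob2 v.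
Proof. by apply: eq_bigr => i _; rewrite big_ord1 expr2. Qed.

Lemma dotv_ge0 v : 0 <= dotv v v.
Proof. by rewrite dotv_frob2 frob2_ge0. Qed.

Lemma dotv_eq0 v : (dotv v v == 0) = (v == 0).
Proof.
apply/eqP/eqP => [|->]; first by rewrite dotv_frob2 => /frob2_eq0.
by rewrite dotvE mulmx0 mxE.
Qed.

Lemma quadE (M : 'M[R]_n) v : quad M v = dotv v (M *m v).
Proof.
apply: eq_bigr => i _; rewrite mxE mulr_sumr.
by apply: eq_bigr => j _; rewrite mulrAC mulrC.
Qed.

Lemma quad_gram (M : 'M[R]_n) v : quad (M^T *m M) v = dotv (M *m v) (M *m v).
Proof. by rewrite quadE !dotvE trmx_mul !mulmxA. Qed.

(** Defined for every list. Orthonormality of [Q] is replaced by the invariant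
    [is_proj (residual_proj Q)], which Gram-Schmidt steps preserve. *)
Definition residual_proj Q : 'M[R]_n := 1%:M - \sum_(q <- Q) q *m q^T.

Definition is_proj P := P^T = P /\ P *m P = P.

Lemma deflateE Q v : deflate Q v = residual_proj Q *m v.
Proof.
rewrite /deflate /residual_proj mulmxBl mul1mx mulmx_suml; congr (_ - _).
apply: eq_bigr => q _; rewrite -mulmxA dotvE.
by rewrite [q^T *m v]mx11_scalar mul_mx_scalar mxE.
Qed.

Lemma residual_proj_step Q v (w := residual_proj Q *m v) :
  residual_proj (gram_schmidt_step Q v) =
  if w == 0 then residual_proj Q
  else residual_proj Q - (dotv w w)^-1 *: (w *m w^T).
Proof.
rewrite /gram_schmidt_step deflateE -/w; case: ifP => // _.
rewrite {1}/residual_proj -cats1 big_cat big_seq1 /= opprD addrA; congr (_ - _).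
rewrite linearZ /= -scalemxAl -scalemxAr scalerA -expr2 exprVn.
by rewrite sqr_sqrtr ?dotv_ge0.
Qed.

(** Since [w] lies in the range of [P], the step subtracts from [P] the orthogonal projection onto a
    line inside that range. *)
Lemma is_proj_step Q v : is_proj (residual_proj Q) ->
  is_proj (residual_proj (gram_schmidt_step Q v)).
Proof.
move=> [sP iP]; rewrite residual_proj_step; move: (residual_proj Q) sP iP => P sP iP.
set w := P *m v; case: eqP => // /eqP w0; split.
  by rewrite linearB linearZ /= sP trmx_mul trmxK.
have Pw : P *m w = w by rewrite /w mulmxA iP.
have wP : w^T *m P = w^T by rewrite -{1}sP -trmx_mul Pw.
have ww : w *m w^T *m (w *m w^T) = dotv w w *: (w *m w^T).
  rewrite mulmxA -[w *m w^T *m w]mulmxA [w^T *m w]mx11_scalar -dotvE.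
  by rewrite mul_mx_scalar -scalemxAl.
have d0 : dotv w w != 0 by rewrite dotv_eq0.
rewrite mulmxBl !mulmxBr iP -!scalemxAl -!scalemxAr mulmxA Pw.
rewrite -[w *m w^T *m P]mulmxA wP ww.
by rewrite !scalerA -mulrA mulVf// mulr1 subrr subr0.
Qed.

Definition residual A Q : R := frob2 (residual_proj Q *m A).

Lemma frob2_projE P A : is_proj P -> frob2 (P *m A) = \tr (A^T *m P *m A).
Proof.
by move=> [sP iP]; rewrite frob2E trmx_mul sP !mulmxA -[_ *m P *m P]mulmxA iP.
Qed.

(** The residual is [\tr (A^T P A)], and [P] loses [w w^T / |w|^2]; the trace therefore drops by
    [|A^T w|^2 / |w|^2], where [A^T w = M s]. *)
Lemma residual_step A Q s (M := A^T *m residual_proj Q *m A)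
    (w := residual_proj Q *m (A *m s)) : is_proj (residual_proj Q) ->
  residual A (gram_schmidt_step Q (A *m s)) =
  if w == 0 then residual A Q
  else residual A Q - dotv (M *m s) (M *m s) / dotv w w.
Proof.
move=> pQ; have pQ' := is_proj_step (A *m s) pQ.
rewrite /residual frob2_projE// residual_proj_step -/w frob2_projE//.
case: ifP => // _; rewrite mulmxBr mulmxBl linearB /=; congr (_ - _).
rewrite -scalemxAr -scalemxAl mxtraceZ mulrC; congr (_ / _).
have -> : M *m s = A^T *m w by rewrite /M /w !mulmxA.
by rewrite dotv_tr [(A^T *m w)^T]trmx_mul trmxK !mulmxA.
Qed.

Lemma residual_step_le A Q s : is_proj (residual_proj Q) ->
  residual A (gram_schmidt_step Q (A *m s)) <= residual A Q.
Proof.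
move=> pQ; rewrite residual_step//; case: ifP => // _.
by rewrite gerBl divr_ge0// dotv_ge0.
Qed.

Lemma is_proj_nil : is_proj (residual_proj [::]).
Proof. by split; rewrite /residual_proj big_nil subr0 ?trmx1 ?mulmx1. Qed.

Lemma is_proj_foldl Q (vs : seq 'cV[R]_n) : is_proj (residual_proj Q) ->
  is_proj (residual_proj (foldl (@gram_schmidt_step R n) Q vs)).
Proof. by elim: vs Q => //= v vs IH Q pQ; apply/IH/is_proj_step. Qed.

Lemma size_gram_schmidt (vs : seq 'cV[R]_n) :
  (size (gram_schmidt vs) <= size vs)%N.
Proof.
suff H Q : (size (foldl (@gram_schmidt_step R n) Q vs) <= size Q + size vs)%N.
  exact: H.
elim: vs Q => [|v vs IH] Q /=; first by rewrite addn0.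
apply: leq_trans (IH _) _; rewrite addnS -addSn leq_add2r /gram_schmidt_step.
by case: ifP; rewrite ?size_rcons// leqnSn.
Qed.

(** Pythagoras: the rows of [P *m A] split orthogonally between the ranges of [P] and [1 - P]. *)
Lemma frob2_proj2_le P A : is_proj P -> frob2 (P *m A *m P) <= frob2 (P *m A).
Proof.
move=> [sP iP]; have -> : frob2 (P *m A) =
    frob2 (P *m A *m P) + frob2 (P *m A *m (1%:M - P)); last first.
  by rewrite lerDl frob2_ge0.
have E X : X^T = X -> X *m X = X ->
    frob2 (P *m A *m X) = \tr ((P *m A)^T *m (P *m A) *m X).
  move=> sX iX; rewrite frob2E trmx_mul sX -!mulmxA mxtrace_mulC.
  by rewrite !mulmxA -[_ *m X *m X]mulmxA iX.
rewrite !E//; last 2 first.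
- by rewrite linearB /= trmx1 sP.
- by rewrite mulmxBl mul1mx mulmxBr mulmx1 iP subrr subr0.
by rewrite -linearD /= -mulmxDr addrCA subrr addr0 mulmx1 frob2E.
Qed.

End Deflation.

(** * Query count and error formula of the estimator *)

Section QueryAll.
Variables (R : realType) (n : nat).
Implicit Types (A : 'M[R]_n) (xs S G : seq 'cV[R]_n).

Lemma run_query_all A xs a :
  run A (query_all xs a) = run A (a [seq A *m x | x <- xs]).
Proof. by elim: xs a => //= x xs IH a; rewrite IH. Qed.

Lemma nqueries_query_all A xs a :
  nqueries A (query_all xs a) = (size xs + nqueries A (a [seq A *m x | x <- xs]))%N.
Proof. by elim: xs a => //= x xs IH a; rewrite IH addSn. Qed.

(** Gram-Schmidt keeps at most one vector per column of [A S], so querying the basis costs no more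
    than querying [S]. *)
Lemma nqueries_hutchpp_alg A S G :
  (nqueries A (hutchpp_alg S G) <= 2 * size S + size G)%N.
Proof.
rewrite /hutchpp_alg !nqueries_query_all /= addn0 size_map mul2n -addnn -addnA.
rewrite leq_add2l leq_add2r; apply: leq_trans (size_gram_schmidt _) _.
by rewrite size_map.
Qed.

(** The exactly computed part cancels: by cyclicity and [P P = P],
    [\tr A - \tr (Q^T A Q) = \tr (P A P)]. The quadratic forms of [A] at deflated vectors are those
    of [P A P], so only Hutchinson's error for [P A P] is left. *)
Lemma hutchpp_alg_error A S G
    (P := residual_proj (gram_schmidt [seq A *m s | s <- S])) :
  \tr A - run A (hutchpp_alg S G) =
  \tr (P *m A *m P) - (size G)%:R^-1 * \sum_(g <- G) quad (P *m A *m P) g.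
Proof.
have [sP iP] : is_proj P by apply/is_proj_foldl/is_proj_nil.
have zipE (s : seq 'cV[R]_n) :
    \sum_(z <- zip s [seq A *m x | x <- s]) dotv z.1 z.2 =
    \sum_(x <- s) dotv x (A *m x).
  by elim: s => [|x s IH]; rewrite /= ?big_nil// !big_cons IH.
rewrite /hutchpp_alg !run_query_all /= !zipE opprD addrA; congr (_ - _).
  rewrite mxtrace_mulC mulmxA iP /P /residual_proj mulmxBl mul1mx raddfB /=.
  congr (_ - _); rewrite mulmx_suml raddf_sum /=; apply: eq_bigr => q _.
  by rewrite dotv_tr [RHS]mxtrace_mulC mulmxA.
congr (_ * _); rewrite big_map; apply: eq_bigr => g _.
by rewrite quadE deflateE -/P !dotvE trmx_mul sP !mulmxA.
Qed.

Lemma sign_cols_row_mx k (b : 'cV[bool]_n) (B : 'M[bool]_(n, k)) :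
  sign_cols R (row_mx b B : 'M_(n, k.+1)) = sgnv R b :: sign_cols R B.
Proof.
rewrite /sign_cols enum_ordSl /= -map_comp; congr (_ :: _).
  apply/colP => i; rewrite !mxE.
  have -> : ord0 = lshift k (0 : 'I_1) :> 'I_(1 + k) by apply: val_inj.
  by rewrite -[b i 0](row_mxEl b B) mxE.
apply: eq_map => j /=; apply/colP => i; rewrite [LHS]mxE [RHS]mxE.
have -> : lift ord0 j = rshift 1 j :> 'I_(1 + k) by apply: val_inj.
by congr (_ ^+ nat_of_bool _); exact: (row_mxEr b B).
Qed.

Lemma size_sign_cols k (B : 'M[bool]_(n, k)) : size (sign_cols R B) = k.
Proof. by rewrite size_map size_enum_ord. Qed.

(** The columns are independent, so the exponential moment of the sum factorizes. *)
Lemma mean_expR_sum_quad k (N : 'M[R]_n) c :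
  mean (fun B : 'M[bool]_(n, k) =>
    expR (c * \sum_(g <- sign_cols R B) quad N g)) =
  (mean (fun b : 'cV[bool]_n => expR (c * quad N (sgnv R b)))) ^+ k.
Proof.
elim: k => [|k IH].
  rewrite (@eq_mean _ _ _ (fun=> 1)) ?mean_cst ?card_sign_gt0// => B.
  have /size0nil -> : size (sign_cols R B) = 0%N by rewrite size_sign_cols.
  by rewrite big_nil mulr0 expR0.
rewrite mean_row_recl exprS -IH mulrC -meanZ; apply: eq_mean => b.
rewrite mulrC -meanZ; apply: eq_mean => B.
by rewrite sign_cols_row_mx big_cons mulrDr expRD.
Qed.

End QueryAll.

(** * Effect of one random sketch column *)

Section GoodStep.
Variables (R : realType) (n : nat).

(** Chernoff's method: an indicator is at most [expR g] as soon as [g] is nonnegative on the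
    event. *)
Lemma mean_pred_le_expR (T : finType) (E : pred T) (g : T -> R) :
  (forall t, E t -> 0 <= g t) -> mean (fun t => (E t)%:R) <= mean (fun t => expR (g t)).
Proof.
move=> Eg; apply: le_mean => t; case: (boolP (E t)) => [/Eg g0|_].
  by rewrite -[leLHS](expR0 R) ler_expR.
exact: expR_ge0.
Qed.

Lemma mean_expR_shift (T : finType) (a : R) (g : T -> R) :
  mean (fun t => expR (a + g t)) = expR a * mean (fun t => expR (g t)).
Proof. by rewrite -meanZ; apply: eq_mean => t; rewrite expRD. Qed.

Lemma expRN_le (x : R) : 0 <= x -> expR (- x) <= (1 + x)^-1.
Proof.
move=> x0; rewrite expRN lef_pV2 ?posrE ?expR_gt0 ?expR_ge1Dx//.
by rewrite ltr_pwDl.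
Qed.

Lemma gram_sgnv_lower_tail (B : 'M[R]_n) (F := frob2 B) : 0 < F ->
  mean (fun b : 'cV[bool]_n => (quad (B^T *m B) (sgnv R b) <= F / 2)%R%:R) <=
    128 / 129 :> R.
Proof.
move=> F0; set N := B^T *m B.
have trN : \tr N = F by rewrite -frob2E.
have FN : frob2 N <= F ^+ 2 by exact: frob2_gram_le.
(* The largest [|c|] that Hanson-Wright allows given [frob2 N <= F ^+ 2]. The exponent becomes
   [1/64 - 1/32 + 8/1024 = - 1/128]. *)
pose c : R := - (32 * F)^-1.
have cF : c * F = - 32^-1 by rewrite /c invfM; field; rewrite gt_eqF.
have cN : c ^+ 2 * frob2 N <= 1024^-1.
  apply: le_trans (_ : c ^+ 2 * F ^+ 2 <= _); first by rewrite ler_wpM2l ?sqr_ge0.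
  by rewrite -exprMn cF sqrrN exprVn lef_pV2 ?posrE ?exprn_gt0 ?ltr0n//; lra.
apply: le_trans (_ : mean (fun b => expR (64^-1 + c * quad N (sgnv R b))) <= _).
  apply: mean_pred_le_expR => b bF.
  have : c * (F / 2) <= c * quad N (sgnv R b).
    by rewrite ler_wnM2l// oppr_le0 invr_ge0 mulr_ge0 ?ler0n ?ltW.
  by rewrite mulrA cF; lra.
rewrite mean_expR_shift; apply: le_trans (ler_wpM2l (expR_ge0 _) (Hanson_Wright cN)) _.
rewrite -expRD trN cF; apply: le_trans (_ : expR (- 128^-1) <= _).
  by rewrite ler_expR; lra.
apply: le_trans (expRN_le _) _; first lra.
by have -> : (1 + 128^-1)^-1 = 128 / 129 :> R by field.
Qed.

Lemma gram_sgnv_upper_tail (B : 'M[R]_n) (F := frob2 B) : 0 < F ->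
  mean (fun b : 'cV[bool]_n => (8256 * F <= quad (B^T *m B) (sgnv R b))%R%:R) <=
    258^-1 :> R.
Proof.
move=> F0; set N := B^T *m B.
have trN : \tr N = F by rewrite -frob2E.
have FN : frob2 N <= F ^+ 2 by exact: frob2_gram_le.
(* As [8256 = 32 * 258], the threshold contributes [- 258] to the exponent. The resulting [1/258]
   leaves room beside the [128/129] of the lower tail. *)
pose c : R := (32 * F)^-1.
have cF : c * F = 32^-1 by rewrite /c invfM; field; rewrite gt_eqF.
have cN : c ^+ 2 * frob2 N <= 1024^-1.
  apply: le_trans (_ : c ^+ 2 * F ^+ 2 <= _); first by rewrite ler_wpM2l ?sqr_ge0.
  by rewrite -exprMn cF exprVn lef_pV2 ?posrE ?exprn_gt0 ?ltr0n//; lra.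
apply: le_trans (_ : mean (fun b => expR (- 258 + c * quad N (sgnv R b))) <= _).
  apply: mean_pred_le_expR => b bF.
  have : c * (8256 * F) <= c * quad N (sgnv R b).
    by rewrite ler_wpM2l// invr_ge0 mulr_ge0 ?ler0n ?ltW.
  by rewrite mulrCA cF; lra.
rewrite mean_expR_shift; apply: le_trans (ler_wpM2l (expR_ge0 _) (Hanson_Wright cN)) _.
rewrite -expRD trN cF; apply: le_trans (_ : expR (- 257) <= _).
  by rewrite ler_expR; lra.
apply: le_trans (expRN_le _) _; first lra.
by have -> : (1 + 257)^-1 = 258^-1 :> R by field.
Qed.

(** For [B = P A], the two conditions bound the numerator from below and the denominator from above
    in the decrease [|M s|^2 / |B s|^2] of the residual. *)
Definition good_step (B : 'M[R]_n) (s : 'cV[R]_n) (M := B^T *m B) : bool :=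
  (frob2 M / 2 < dotv (M *m s) (M *m s)) && (quad M s < 8256 * frob2 B).

Lemma frob2_gram_gt0 (B : 'M[R]_n) : 0 < frob2 B -> 0 < frob2 (B^T *m B).
Proof.
move=> B0; rewrite lt_neqAle frob2_ge0 andbT eq_sym; apply: contraTneq B0.
by move=> /frob2_eq0 BB; rewrite frob2E BB mxtrace0 ltxx.
Qed.

Lemma good_step_prob (B : 'M[R]_n) : 0 < frob2 B ->
  mean (fun b : 'cV[bool]_n => (~~ good_step B (sgnv R b))%:R) <= 257 / 258 :> R.
Proof.
move=> B0; have M0 := frob2_gram_gt0 B0.
apply: le_trans (_ : 128 / 129 + 258^-1 <= _); last by lra.
apply: le_trans (lerD (gram_sgnv_lower_tail M0) (gram_sgnv_upper_tail B0)).
rewrite -meanD; apply: le_mean => b; rewrite /good_step negb_and -!leNgt !quad_gram.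
by rewrite -natrD ler_nat; case: (_ <= _)%R; case: (_ <= _)%R.
Qed.

(** The constant is [2 * 8256], from the two halves of [good_step]. The degenerate case [w = 0]
    cannot occur, since it would force [M *m s = 0]. *)
Lemma good_step_residual (A : 'M[R]_n) Q s : is_proj (residual_proj Q) ->
  good_step (residual_proj Q *m A) s -> 0 < residual A Q ->
  residual A (gram_schmidt_step Q (A *m s)) <=
  residual A Q - frob2 (A^T *m residual_proj Q *m A) / (16512 * residual A Q).
Proof.
move=> pQ; rewrite /good_step; set B := residual_proj Q *m A.
have BB : B^T *m B = A^T *m residual_proj Q *m A.
  case: pQ => sP iP; rewrite trmx_mul sP !mulmxA.
  by rewrite -[_ *m _ *m residual_proj Q]mulmxA iP.
rewrite quad_gram BB; set M := A^T *m _ *m A.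
have wE : B *m s = residual_proj Q *m (A *m s) by rewrite mulmxA.
move=> /andP[lo hi] r0; rewrite residual_step// -/M -wE.
have F0 : 0 < frob2 M by rewrite /M -BB frob2_gram_gt0.
case: eqP => [w0|/eqP w0].
  have Ms0 : M *m s = 0 by rewrite /M -BB -mulmxA w0 mulmx0.
  by move: lo; rewrite Ms0 dotvE mulmx0 mxE; lra.
rewrite lerD2l lerN2.
have d0 : 0 < dotv (B *m s) (B *m s).
  by rewrite lt_neqAle eq_sym dotv_eq0 w0 dotv_ge0.
rewrite ler_pdivlMr// mulrAC ler_pdivrMr ?mulr_gt0//.
rewrite /residual -/B in r0 hi *.
apply: le_trans (_ : frob2 M * (8256 * frob2 B) <= _); first by rewrite ler_pM2l// ltW.
by have := ler_wpM2r (ltW r0) (ltW lo); lra.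
Qed.

End GoodStep.

(** * Comparison with singular values *)

Lemma char_poly_conj (F : comNzRingType) n (U V D : 'M[F]_n) :
  V *m U = 1%:M -> char_poly (V *m D *m U) = char_poly D.
Proof.
move=> VU; rewrite /char_poly /char_poly_mx.
have VU' : map_mx polyC V *m map_mx polyC U = 1%:M by rewrite -map_mxM VU map_mx1.
have -> : 'X%:M - map_mx polyC (V *m D *m U) =
    map_mx polyC V *m ('X%:M - map_mx polyC D) *m map_mx polyC U.
  by rewrite !map_mxM mulmxBr mulmxBl mul_mx_scalar -scalemxAl VU' scalemx1.
by rewrite !det_mulmx mulrAC -det_mulmx VU' det1 mul1r.
Qed.

Section GramSpectrum.
Variables (R : realType) (n : nat).
Local Notation C := R[i].
Local Notation toC := (map_mx (real_complex R)).
Local Notation star X := (map_mx (@Num.conj C) X^T).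

Lemma star_toC m k (X : 'M[R]_(m, k)) : star (toC X) = toC X^T.
Proof. by apply/matrixP => i j; rewrite !mxE; exact: conjc_real. Qed.

Lemma starM m k l (X : 'M[C]_(m, k)) (Y : 'M[C]_(k, l)) :
  star (X *m Y) = star Y *m star X.
Proof. by rewrite trmx_mul map_mxM. Qed.

Lemma starK m k (X : 'M[C]_(m, k)) : star (star X) = X.
Proof. by apply/matrixP => i j; rewrite !mxE conjCK. Qed.

Lemma mulmx_star_diag_ge0 m k (X : 'M[C]_(m, k)) i : 0 <= (X *m star X) i i.
Proof. by rewrite mxE sumr_ge0// => j _; rewrite !mxE mul_conjC_ge0. Qed.

Lemma mulmx_star_diag_ge (X : 'M[C]_n) i :
  X i i \is Num.real -> X i i ^+ 2 <= (X *m star X) i i.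
Proof.
move=> /CrealP Xr; rewrite mxE (bigD1 i)//= !mxE Xr expr2 lerDl.
by rewrite sumr_ge0// => j _; rewrite !mxE mul_conjC_ge0.
Qed.

(** Spectral theorem for the real symmetric, hence normal, matrix [A^T A] over the complex numbers.
    Unique factorization of the characteristic polynomial matches its diagonal form with the squared
    singular values, which also shows that the diagonal is real. *)
Lemma gram_diag (A : 'M[R]_n) : exists (U : 'M[C]_n) (d : 'I_n -> R),
  [/\ U *m star U = 1%:M,
      forall i, (U *m toC (A^T *m A) *m star U) i i = (d i)%:C%C &
      perm_eq [seq d i | i <- enum 'I_n]
              [seq x ^+ 2 | x <- singular_values A]].
Proof.
set M := A^T *m A; pose Mc := toC M.
have Msym : M^T = M by rewrite trmx_mul trmxK.
have Mnormal : Mc \is normalmx.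
  by apply/normalmxP; rewrite star_toC Msym.
pose U := spectralmx Mc; pose d := spectral_diag Mc.
have UU : U *m star U = 1%:M by exact/unitarymxP/spectral_unitarymx.
have UU' : star U *m U = 1%:M by exact: mulmx1C.
have Mdiag : Mc = star U *m diag_mx d *m U.
  by move/orthomx_spectralP: Mnormal; rewrite invmx_unitary// spectral_unitarymx.
have Ud : U *m Mc *m star U = diag_mx d.
  by rewrite Mdiag !mulmxA UU mul1mx -mulmxA UU mulmx1.
have dperm : perm_eq [seq d 0 i | i <- enum 'I_n]
    [seq (x ^+ 2)%:C%C | x <- singular_values A].
  apply: prod_XsubC_eq; rewrite big_map big_enum big_map /=.
  have -> : \prod_i ('X - (d 0 i)%:P) = char_poly Mc.
    rewrite Mdiag char_poly_conj// char_poly_trig ?diag_mx_is_trig//.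
    by apply: eq_bigr => i _; rewrite mxE eqxx.
  rewrite -map_char_poly (singular_valuesP A) big_map rmorph_prod /=.
  by apply: eq_bigr => x _; rewrite rmorphB /= map_polyX map_polyC.
have dE i : d 0 i = (complex.Re (d 0 i))%:C%C.
  have : d 0 i \in [seq d 0 i | i <- enum 'I_n] by rewrite map_f ?mem_enum.
  by rewrite (perm_mem dperm) => /mapP[x _ ->].
exists U, (fun i => complex.Re (d 0 i)); split=> //.
  by move=> i; rewrite Ud mxE eqxx -dE.
have := perm_map (@complex.Re R) dperm; rewrite -!map_comp.
by congr perm_eq; apply: eq_map.
Qed.

(* The weights are the quadratic forms of [A^T P A] at the right singular
   vectors of [A]; they are at most the squared singular values because
   [A^T A - A^T P A] is positive semidefinite. *)
Lemma residual_weights (A P : 'M[R]_n) (M := A^T *m P *m A) : is_proj P ->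
  exists m d : 'I_n -> R,
  [/\ forall i, 0 <= m i <= d i,
      \sum_i m i = \tr M,
      \sum_i m i ^+ 2 <= frob2 M &
      perm_eq [seq d i | i <- enum 'I_n]
              [seq x ^+ 2 | x <- singular_values A]].
Proof.
move=> [sP iP]; have [U [d [UU dE dperm]]] := gram_diag A.
have UU' : star U *m U = 1%:M by exact: mulmx1C.
pose W X := U *m toC X *m star U.
have W_ge0 (B : 'M[R]_n) i : 0 <= W (B^T *m B) i i.
  have -> : W (B^T *m B) = U *m toC B^T *m star (U *m toC B^T).
    by rewrite starM star_toC trmxK !mulmxA -[U *m _ *m toC B]mulmxA -map_mxM.
  exact: mulmx_star_diag_ge0.
have ME : M = (P *m A)^T *m (P *m A).
  by rewrite trmx_mul sP !mulmxA -[_ *m P *m P]mulmxA iP.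
have M'E : A^T *m A - M = ((1%:M - P) *m A)^T *m ((1%:M - P) *m A).
  have iP' : (1%:M - P) *m (1%:M - P) = 1%:M - P.
    by rewrite mulmxBl mul1mx mulmxBr mulmx1 iP subrr subr0.
  rewrite trmx_mul linearB /= trmx1 sP !mulmxA.
  rewrite -[_ *m (1%:M - P) *m (1%:M - P)]mulmxA iP'.
  by rewrite mulmxBr mulmx1 mulmxBl.
have Msym : M^T = M by rewrite ME trmx_mul trmxK.
have WM i : W M i i = (complex.Re (W M i i))%:C%C.
  have := W_ge0 (P *m A) i; rewrite -ME lecE => /andP[/eqP /= + _].
  by case: (W M i i) => a b /= ->.
have trW X : \tr (W X) = (\tr X)%:C%C.
  by rewrite /W mxtrace_mulC mulmxA UU' mul1mx trace_map_mx.
exists (fun i => complex.Re (W M i i)), d; split => //.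
- move=> i; apply/andP; split.
    by have := W_ge0 (P *m A) i; rewrite -ME lecE => /andP[].
  have := W_ge0 ((1%:M - P) *m A) i; rewrite -M'E.
  have -> : W (A^T *m A - M) = W (A^T *m A) - W M.
    by rewrite /W map_mxB mulmxBr mulmxBl.
  by rewrite [X in 0 <= X]mxE [X in _ + X]mxE subr_ge0 dE lecE => /andP[].
- apply: complexI; rewrite -trW rmorph_sum /=.
  by apply: eq_bigr => i _; rewrite -WM.
(* By unitary invariance [frob2 M] is the squared Frobenius norm of [W M], and the weights are only
   its diagonal entries. *)
suff : (\sum_i complex.Re (W M i i) ^+ 2)%:C%C <= (frob2 M)%:C%C by rewrite lecR.
rewrite frob2E -trW Msym.
have -> : W (M *m M) = W M *m star (W M).
  rewrite /W !starM starK star_toC Msym map_mxM !mulmxA.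
  by rewrite -[_ *m star U *m U]mulmxA UU' mulmx1.
rewrite rmorph_sum /=; apply: ler_sum => i _.
rewrite rmorphXn /= -WM; apply: mulmx_star_diag_ge.
by rewrite ger0_real// ME W_ge0.
Qed.

End GramSpectrum.

(** * Decay of the residual *)

Section SchattenDecay.
Variables (R : realType) (n : nat).
Implicit Types (p : R) (A P : 'M[R]_n) (Q : seq 'cV[R]_n).

Definition schatten_sum p A : R := \sum_(x <- singular_values A) x `^ p.

Lemma schatten_sum_ge0 p A : 0 <= schatten_sum p A.
Proof. by apply: sumr_ge0 => x _; exact: powR_ge0. Qed.

Lemma singular_values_ge0 A x : x \in singular_values A -> 0 <= x.
Proof. by move=> /mapP[y _ ->]; exact: sqrtr_ge0. Qed.

Lemma schatten_sumE p A (d : 'I_n -> R) :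
  perm_eq [seq d i | i <- enum 'I_n] [seq x ^+ 2 | x <- singular_values A] ->
  \sum_i d i `^ (p / 2) = schatten_sum p A.
Proof.
move=> dA; rewrite -(big_enum _ _ _ (fun i => d i `^ (p / 2))) /=.
rewrite -(big_map d predT (fun x => x `^ (p / 2))) (perm_big _ dA) big_map.
rewrite /schatten_sum big_seq [RHS]big_seq.
apply: eq_bigr => x /singular_values_ge0 x0.
by rewrite -powR_mulrn// -powRrM mulrCA divff ?pnatr_eq0// mulr1.
Qed.

(** Split the weights at [tau]: a small one is [m^(1-p/2) m^(p/2) <= tau^(1-p/2) sigma^p], a large
    one is at most [m^2 / tau]. *)
Lemma residual_interpolation p A P tau : 1 <= p <= 2 -> is_proj P -> 0 < tau ->
  frob2 (P *m A) <=
    tau `^ (1 - p / 2) * schatten_sum p A + frob2 (A^T *m P *m A) / tau.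
Proof.
move=> /andP[p1 p2] pP tau0; rewrite frob2_projE//.
have [m [d [md <- mM dA]]] := residual_weights A pP.
rewrite -(schatten_sumE p dA) mulr_sumr.
apply: le_trans (_ : _ <= \sum_i tau `^ (1 - p / 2) * d i `^ (p / 2) +
    (\sum_i m i ^+ 2) / tau) _; last first.
  by rewrite lerD2l ler_pM2r ?invr_gt0.
rewrite mulr_suml -big_split /=; apply: ler_sum => i _.
have /andP[m0 m_le] := md i; have [mt|mt] := leP (m i) tau.
  apply: le_trans (_ : _ <= tau `^ (1 - p / 2) * d i `^ (p / 2)) _; last first.
    by rewrite lerDl divr_ge0 ?sqr_ge0 ?ltW.
  have -> : m i = m i `^ (1 - p / 2) * m i `^ (p / 2).
    rewrite -powRD; last by rewrite subrK oner_eq0.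
    by rewrite subrK powRr1.
  by rewrite ler_pM ?powR_ge0//; apply: ge0_ler_powR; rewrite ?nnegrE//; lra.
apply: le_trans (_ : _ <= m i ^+ 2 / tau) _; last first.
  by rewrite lerDr mulr_ge0 ?powR_ge0.
by rewrite ler_pdivlMr// expr2 ler_wpM2l// ltW.
Qed.

(** Serves the endpoint [p = 2], where the decay exponent [p / (2 - p)] degenerates. *)
Lemma residual_le_schatten_sum2 A P : is_proj P ->
  frob2 (P *m A) <= schatten_sum 2 A.
Proof.
move=> pP; rewrite frob2_projE//.
have [m [d [md <- _ dA]]] := residual_weights A pP.
rewrite -(schatten_sumE 2 dA); apply: ler_sum => i _.
have /andP[m0 m_le] := md i; rewrite divff ?pnatr_eq0// powRr1//.
exact: le_trans m0 m_le.
Qed.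

Lemma schatten_sum_gt0 p A P : 1 <= p <= 2 -> is_proj P ->
  0 < frob2 (P *m A) -> 0 < schatten_sum p A.
Proof.
move=> p12 pP t0; rewrite lt_neqAle schatten_sum_ge0 andbT eq_sym.
have T0 : 0 < frob2 (A^T *m P *m A).
  case: (pP) => sP iP; have := frob2_gram_gt0 t0.
  by rewrite trmx_mul sP !mulmxA -[_ *m P *m P]mulmxA iP.
set t := frob2 (P *m A) in t0 *; set T := frob2 _ in T0.
(* With a zero Schatten sum, this choice of [tau] turns the interpolation into [t <= t / 2]. *)
have tau0 : 0 < 2 * T / t by rewrite divr_gt0// mulr_gt0.
have TE : T / (2 * T / t) = t / 2 by field; rewrite !gt_eqF.
apply: contraTN t0 => /eqP N0; rewrite -leNgt.
have := residual_interpolation A p12 pP tau0; rewrite N0 mulr0 add0r -/t -/T TE.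
by lra.
Qed.

(** The exponent [1 + p / (2 - p)] is the inverse of [1 - p / 2]. It makes the first term of the
    interpolation at [tau] equal to [t / 2], so the second must supply the other half. *)
Lemma residual_fourth_moment p A P (t := frob2 (P *m A)) :
  1 <= p -> p < 2 -> is_proj P -> 0 < t ->
  (t / (2 * schatten_sum p A)) `^ (1 + p / (2 - p)) * t / 2 <=
    frob2 (A^T *m P *m A).
Proof.
move=> p1 p2 pP t0.
have p12 : 1 <= p <= 2 by rewrite p1 ltW.
have N0 := schatten_sum_gt0 p12 pP t0; set N := schatten_sum p A in N0 *.
set y := t / (2 * N); have y0 : 0 < y by rewrite divr_gt0// mulr_gt0.
set tau := y `^ _; have tau0 : 0 < tau by exact: powR_gt0.
have tauE : tau `^ (1 - p / 2) = y.
  rewrite -powRrM; have -> : (1 + p / (2 - p)) * (1 - p / 2) = 1.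
    by field; rewrite subr_eq0 gt_eqF.
  by rewrite powRr1// ltW.
have := residual_interpolation A p12 pP tau0; rewrite tauE -/N -/t.
have -> : y * N = t / 2 by rewrite /y; field; rewrite gt_eqF.
move=> t_le; have : t / 2 <= frob2 (A^T *m P *m A) / tau by lra.
by rewrite ler_pdivlMr//; lra.
Qed.

End SchattenDecay.

(** * Expected decay of a potential of the residual *)

Section Potential.
Variables (R : realType) (n : nat) (A : 'M[R]_n) (f : R -> R).
Hypothesis f_ge0 : forall x, 0 <= f x.
Hypothesis f0 : f 0 = 0.
Hypothesis f_homo : forall x y, 0 <= x -> x <= y -> f x <= f y.
Hypothesis f_half : forall Q s, is_proj (residual_proj Q) -> 0 < residual A Q ->
  good_step (residual_proj Q *m A) s ->
  f (residual A (gram_schmidt_step Q (A *m s))) <= f (residual A Q) / 2.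

(** A good column, of probability at least [1/258], halves the potential; any other does not
    increase it. Hence the factor [1/2 + 1/2 * 257/258]. *)
Lemma mean_potential_step Q : is_proj (residual_proj Q) ->
  mean (fun b : 'cV[bool]_n =>
    f (residual A (gram_schmidt_step Q (A *m sgnv R b)))) <=
  515 / 516 * f (residual A Q).
Proof.
move=> pQ; have r'_ge0 b : 0 <= residual A (gram_schmidt_step Q (A *m sgnv R b)).
  exact: frob2_ge0.
have [r0|r0] := leP (residual A Q) 0.
  have f'0 b : f (residual A (gram_schmidt_step Q (A *m sgnv R b))) = 0.
    rewrite -f0; congr f; apply/le_anti; rewrite r'_ge0 andbT.
    by apply: le_trans r0; exact: residual_step_le.
  rewrite (eq_mean f'0) mean_cst ?card_sign_gt0//.
  by rewrite mulr_ge0// divr_ge0.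
pose g (b : 'cV[bool]_n) := ~~ good_step (residual_proj Q *m A) (sgnv R b).
have g_le : mean (fun b => (g b)%:R) <= 257 / 258 :> R by exact: good_step_prob.
apply: le_trans (_ : mean (fun b => f (residual A Q) / 2 +
    f (residual A Q) / 2 * (g b)%:R) <= _).
  apply: le_mean => b; rewrite /g; case: (boolP (good_step _ _)) => [gb|_] /=.
    by rewrite mulr0 addr0 f_half.
  by rewrite mulr1 -splitr f_homo// residual_step_le.
rewrite meanD mean_cst ?card_sign_gt0// meanZ.
by have := ler_wpM2l (f_ge0 (residual A Q)) g_le; lra.
Qed.

Lemma mean_potential k Q : is_proj (residual_proj Q) ->
  mean (fun B : 'M[bool]_(n, k) => f (residual A (foldl (@gram_schmidt_step R n) Q
    [seq A *m s | s <- sign_cols R B]))) <=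
  (515 / 516) ^+ k * f (residual A Q).
Proof.
elim: k Q => [|k IH] Q pQ.
  rewrite expr0 mul1r (@eq_mean _ _ _ (fun=> f (residual A Q))) => [|B].
    by rewrite mean_cst ?card_sign_gt0.
  by have /size0nil -> : size (sign_cols R B) = 0%N by rewrite size_sign_cols.
rewrite mean_row_recl; under eq_mean => b.
  under eq_mean do rewrite sign_cols_row_mx /=.
  over.
apply: le_trans (_ : mean (fun b => (515 / 516) ^+ k *
    f (residual A (gram_schmidt_step Q (A *m sgnv R b)))) <= _).
  by apply: le_mean => b; apply/IH/is_proj_step.
rewrite meanZ exprSr -mulrA ler_wpM2l ?exprn_ge0 ?divr_ge0//.
exact: mean_potential_step.
Qed.

End Potential.

(** * Exponential tail bound for the residual *)

Section ResidualTail.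
Variable R : realType.

(* Discrete form of: [y' = - c y^(1+a)] makes [1 / (c y^a)] grow at rate
   [a >= 1]. *)
Lemma inv_powR_growth (a c y y' : R) : 1 <= a -> 0 < c -> 0 < y -> 0 < y' ->
  y' <= y - c * y `^ (1 + a) -> (y `^ a * c)^-1 + 1 <= (y' `^ a * c)^-1.
Proof.
move=> a1 c0 y0 y'0; rewrite powRD ?(gt_eqF y0) ?implybT// powRr1 ?(ltW y0)//.
set Y := y `^ a; have Y0 : 0 < Y by exact: powR_gt0.
pose z := Y * c; have z0 : 0 < z by exact: mulr_gt0.
have -> : y - c * (y * Y) = y * (1 - z) by rewrite /z; ring.
move=> y'_le; have z1 : 0 < 1 - z.
  by rewrite -(pmulr_rgt0 _ y0); exact: lt_le_trans y'_le.
(* Since [a >= 1] and [1 - z <= 1], [(1 - z)^a <= 1 - z]. *)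
have : y' `^ a <= Y * (1 - z).
  apply: le_trans (_ : (y * (1 - z)) `^ a <= _).
    by apply: ge0_ler_powR => //; rewrite ?nnegrE ?mulr_ge0 ?ltW//; lra.
  rewrite powRM ?(ltW y0) ?(ltW z1)// ler_pM2l//.
  by apply: ge1r_powR => //; rewrite z1; lra.
move=> y'a; have {y'a} : y' `^ a * c <= z * (1 - z).
  by rewrite /z mulrAC ler_pM2r.
move=> y'a; apply: le_trans (_ : (z * (1 - z))^-1 <= _); last first.
  by rewrite lef_pV2 ?posrE ?mulr_gt0 ?powR_gt0.
rewrite -/z -[leRHS]mul1r ler_pdivlMr ?mulr_gt0//.
have -> : (z^-1 + 1) * (z * (1 - z)) = 1 - z ^+ 2 by field; rewrite gt_eqF.
by have := sqr_ge0 z; lra.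
Qed.

Lemma expRN_half (x y : R) : x + 1 <= y -> expR (- y) <= expR (- x) / 2.
Proof.
move=> xy; apply: le_trans (_ : expR (- x - 1) <= _).
  by rewrite ler_expR -opprD lerN2.
by rewrite expRD ler_wpM2l ?expR_ge0//; exact: expRN_le.
Qed.

(** The quantity [h] grows by 1 at each good column, so [expR (- h)] is halved there; Markov's
    inequality at the threshold [b] then gives the tail. *)
Lemma residual_tail n p (A : 'M[R]_n) k b (N := schatten_sum p A) :
  1 <= p -> p < 2 -> 0 < N -> 0 < b ->
  mean (fun B : 'M[bool]_(n, k) =>
    (b < residual A (gram_schmidt [seq A *m s | s <- sign_cols R B]))%R%:R) <=
  (515 / 516) ^+ k *
    expR (((b / (2 * N)) `^ (p / (2 - p)) * (516 * 128 * N)^-1)^-1).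
Proof.
move=> p1 p2 N0 b0; set a := p / (2 - p); set c := (516 * 128 * N)^-1.
have a1 : 1 <= a by rewrite ler_pdivlMr ?subr_gt0//; lra.
have c0 : 0 < c by rewrite invr_gt0 !mulr_gt0.
have N20 : 0 < 2 * N by rewrite mulr_gt0.
pose h t := ((t / (2 * N)) `^ a * c)^-1.
have h_ge0 t : 0 <= h t by rewrite invr_ge0 mulr_ge0 ?powR_ge0// ltW.
have h_homo t t' : 0 < t' -> t' <= t -> h t <= h t'.
  move=> t'0 tt'; have t0 := lt_le_trans t'0 tt'.
  rewrite lef_pV2 ?posrE ?mulr_gt0 ?powR_gt0 ?divr_gt0// ler_pM2r//.
  apply: ge0_ler_powR; first by lra.
  - by rewrite nnegrE divr_ge0 ?ltW.
  - by rewrite nnegrE divr_ge0 ?ltW.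
  - by rewrite ler_pM2r ?invr_gt0.
(* As [0^-1 = 0], the formula would give 1 at a vanishing residual; the limit value 0 is imposed
   instead. *)
pose f t := if t <= 0 then 0 else expR (- h t).
have f_ge0 t : 0 <= f t by rewrite /f; case: ifP; rewrite ?expR_ge0.
have f0 : f 0 = 0 by rewrite /f lexx.
have f_homo x y : 0 <= x -> x <= y -> f x <= f y.
  move=> _ xy; rewrite {1}/f; case: (leP x 0) => [_|x0]; first by rewrite f_ge0.
  by rewrite /f [y <= 0]leNgt (lt_le_trans x0 xy) /= ler_expR lerN2 h_homo.
have f_half Q s : is_proj (residual_proj Q) -> 0 < residual A Q ->
    good_step (residual_proj Q *m A) s ->
    f (residual A (gram_schmidt_step Q (A *m s))) <= f (residual A Q) / 2.
  move=> pQ t0 good; set t := residual A Q in t0 *; set t' := residual _ _.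
  rewrite {1}/f; case: (leP t' 0) => [_|t'0]; first by rewrite divr_ge0.
  rewrite /f [t <= 0]leNgt t0 /=.
  pose y := t / (2 * N); pose T := frob2 (A^T *m residual_proj Q *m A).
  have T_ge : y `^ (1 + a) * t / 2 <= T by exact: residual_fourth_moment.
  have t'_le : t' <= t - T / (16512 * t) by exact: good_step_residual.
  have drop : t' <= t - y `^ (1 + a) / 516 / 64.
    apply: le_trans t'_le _; rewrite lerD2l lerN2 ler_pdivlMr ?mulr_gt0//.
    by lra.
  have y'_le : t' / (2 * N) <= y - c * y `^ (1 + a).
    rewrite ler_pdivrMr//; apply: le_trans drop _.
    rewrite le_eqVlt; apply/orP; left; apply/eqP; rewrite /y /c.
    by move: (_ `^ _) => Y; field; rewrite gt_eqF.
  have ht : h t + 1 <= h t' by apply: inv_powR_growth; rewrite ?divr_gt0.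
  exact: expRN_half.
have := mean_potential f_ge0 f0 f_homo f_half k (@is_proj_nil R n).
set X := mean _ => X_le.
apply: le_trans (_ : expR (h b) * X <= _).
  rewrite -meanZ; apply: le_mean => B; rewrite /gram_schmidt.
  set t := residual _ _; case: (ltP b t) => [bt|_]; last first.
    by rewrite mulr_ge0 ?expR_ge0.
  rewrite /f [t <= 0]leNgt (lt_trans b0 bt) /= -expRD -[leLHS](expR0 R) ler_expR.
  by rewrite subr_ge0 h_homo// ltW.
rewrite mulrC ler_wpM2r ?expR_ge0//; apply: le_trans X_le _.
rewrite ler_piMr ?exprn_ge0 ?divr_ge0//.
rewrite /f; case: ifP => // _; rewrite -[leRHS](expR0 R) ler_expR oppr_le0.
exact: h_ge0.
Qed.

End ResidualTail.

(** * Tail of Hutchinson's estimator *)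

Section HutchinsonTail.
Variables (R : realType) (n : nat).

Lemma mean_pred_or (T : finType) (E E1 E2 : pred T) :
  (forall t, E t -> E1 t || E2 t) ->
  mean (fun t => (E t)%:R) <=
    mean (fun t => (E1 t)%:R) + mean (fun t => (E2 t)%:R) :> R.
Proof.
move=> E12; rewrite -meanD; apply: le_mean => t; rewrite -natrD ler_nat.
by have := E12 t; case: (E t) => // /(_ isT); case: (E1 t) => //= ->.
Qed.

(** Chernoff bound whose exponent is [- 11 L + 8 L]. Either sign of [c] is allowed, so that both
    tails are covered; [1024 * L <= l] places [c] in the range of Hanson-Wright. *)
Lemma sum_quad_tail l (M : 'M[R]_n) u c L : 0 < L -> 1024 * L <= l%:R ->
  l%:R * (c ^+ 2 * frob2 M) <= L -> c * u = 11 * L ->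
  mean (fun B : 'M[bool]_(n, l) =>
    (0 <= c * (\sum_(g <- sign_cols R B) quad M g - l%:R * \tr M - u))%R%:R) <=
  expR (- (3 * L)).
Proof.
move=> L0 Ll cM cu.
have lgt0 : 0 < l%:R :> R by apply: lt_le_trans Ll; rewrite mulr_gt0.
have cM' : c ^+ 2 * frob2 M <= 1024^-1.
  by rewrite -(ler_pM2l lgt0); apply: le_trans cM _; lra.
set a := - (c * (l%:R * \tr M) + 11 * L).
apply: le_trans (_ : mean (fun B : 'M[bool]_(n, l) =>
    expR (a + c * \sum_(g <- sign_cols R B) quad M g)) <= _).
  by apply: mean_pred_le_expR => B; rewrite !mulrBr cu /a; lra.
rewrite mean_expR_shift mean_expR_sum_quad.
apply: le_trans (_ : expR a * expR (c * \tr M + 8 * (c ^+ 2 * frob2 M)) ^+ l <= _).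
  rewrite ler_wpM2l ?expR_ge0// lerXn2r ?nnegrE ?expR_ge0//.
    by apply: mean_ge0 => b; exact: expR_ge0.
  exact: Hanson_Wright.
by rewrite -expRM_natl -expRD ler_expR /a; lra.
Qed.

Lemma hutchinson_tail l (M : 'M[R]_n) e L : 0 < e -> 0 < L -> 1024 * L <= l%:R ->
  121 * L * frob2 M <= l%:R * e ^+ 2 ->
  mean (fun B : 'M[bool]_(n, l) => (e <
    `|\tr M - l%:R^-1 * \sum_(g <- sign_cols R B) quad M g|)%R%:R) <=
  2 * expR (- (3 * L)).
Proof.
move=> e0 L0 Ll Me.
have l0 : 0 < l%:R :> R by apply: lt_le_trans Ll; rewrite mulr_gt0.
(* Chosen to give [c * u = 11 * L] at [u = l * e]; the variance condition of [sum_quad_tail] then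
   becomes the hypothesis with [121 = 11^2]. *)
pose c := 11 * L / (l%:R * e).
have c0 : 0 < c by rewrite divr_gt0 ?mulr_gt0.
have cu : c * (l%:R * e) = 11 * L by rewrite divfK// gt_eqF// mulr_gt0.
have cM : l%:R * (c ^+ 2 * frob2 M) <= L.
  have -> : l%:R * (c ^+ 2 * frob2 M) = L / (l%:R * e ^+ 2) * (121 * L * frob2 M).
    by rewrite /c; field; rewrite !gt_eqF.
  apply: le_trans (_ : L / (l%:R * e ^+ 2) * (l%:R * e ^+ 2) <= _).
    by rewrite ler_wpM2l// ltW// divr_gt0 ?mulr_gt0 ?exprn_gt0.
  by rewrite divfK// gt_eqF// mulr_gt0// exprn_gt0.
have cM' : l%:R * ((- c) ^+ 2 * frob2 M) <= L by rewrite sqrrN.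
have cu' : (- c) * (- (l%:R * e)) = 11 * L by rewrite mulrNN.
rewrite mulr_natl mulr2n.
apply: le_trans (lerD (sum_quad_tail L0 Ll cM cu) (sum_quad_tail L0 Ll cM' cu')).
apply: mean_pred_or => B; set S := \sum_(g <- _) _.
rewrite pmulr_rge0// nmulr_rge0 ?oppr_lt0// opprK => eS.
have ES : S = l%:R * (l%:R^-1 * S) by rewrite mulrA divff ?mul1r// gt_eqF.
move: eS; rewrite {2 3}ES -!mulrBr -[X in _ || (X <= 0)]mulrDr => eS.
rewrite pmulr_rge0// pmulr_rle0//.
by move: eS; rewrite lter_normr => /orP[]; lra.
Qed.

End HutchinsonTail.

(** * Choice of parameters *)

Section HutchppError.
Variable R : realType.

Lemma powR_sqrt_ratio (p L eps : R) : 0 < p -> 0 < L -> 0 < eps ->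
  ((Num.sqrt L / eps) `^ p) `^ (2 / p) = L / eps ^+ 2.
Proof.
move=> p0 L0 e0; rewrite -powRrM mulrCA divff ?gt_eqF// mulr1.
rewrite (powR_mulrn 2); last by rewrite divr_ge0 ?sqrtr_ge0// ltW.
by rewrite expr_div_n sqr_sqrtr// ltW.
Qed.

(** The threshold is the largest residual for which [hutchinson_tail] applies with
    [e = eps * schatten_norm p A]. *)
Lemma residual_fail n (A : 'M[R]_n) (p eps L l : R) (k : nat) :
  1 <= p <= 2 -> 0 < eps -> 0 < L -> 0 < schatten_sum p A ->
  242 * (Num.sqrt L / eps) `^ p <= l -> 1024 * L <= l -> k%:R = 516 * 274 * l ->
  mean (fun B : 'M[bool]_(n, k) =>
    (l * (eps * schatten_norm p A) ^+ 2 / (121 * L) <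
     residual A (gram_schmidt [seq A *m s | s <- sign_cols R B]))%R%:R) <=
  expR (- (2 * L)).
Proof.
move=> /andP[p1 p2] e0 L0; set N := schatten_sum p A => N0 Xl Ll kE.
have p0 : 0 < p by lra.
have l0 : 0 < l by lra.
rewrite /schatten_norm -/(schatten_sum p A) -/N; set s := N `^ p^-1.
have s0 : 0 < s by exact: powR_gt0.
have sN : s `^ p = N by rewrite -powRrM mulVf ?gt_eqF// powRr1// ltW.
set b := l * _ / _.
have b0 : 0 < b by rewrite divr_gt0 ?mulr_gt0 ?exprn_gt0 ?mulr_gt0.
set X := (Num.sqrt L / eps) `^ p in Xl.
(* [242 = 2 * 121]: 121 from the threshold [b], 2 from the scaling [b / (2 * N)]. *)
pose w := l / 242; have w0 : 0 < w by rewrite divr_gt0.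
have Xw : X <= w by rewrite ler_pdivlMr//; lra.
have L_le : L / eps ^+ 2 <= w `^ (2 / p).
  rewrite -(powR_sqrt_ratio p0 L0 e0) -/X.
  apply: ge0_ler_powR => //; last by rewrite nnegrE ltW.
  - by rewrite ltW// divr_gt0.
  - by rewrite nnegrE powR_ge0.
have e20 : 0 < eps ^+ 2 by rewrite exprn_gt0.
(* At [p = 2] the residual is below the threshold for every sketch, so failure has probability 0. *)
move: p2; rewrite le_eqVlt => /predU1P[p2|p2].
  rewrite (@eq_mean _ _ _ (fun=> 0)) ?mean_cst ?card_sign_gt0 ?expR_ge0// => B.
  rewrite ltNge; set r := residual _ _; suff -> : r <= b by [].
  have r_le : r <= N.
    by rewrite /N p2; apply/residual_le_schatten_sum2/is_proj_foldl/is_proj_nil.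
  apply: le_trans r_le _; rewrite -sN p2 (powR_mulrn 2) ?(ltW s0)//.
  rewrite /b ler_pdivlMr ?mulr_gt0// exprMn.
  move: L_le; rewrite p2 divff ?pnatr_eq0// powRr1 ?(ltW w0)// ler_pdivrMr// /w => L_le.
  have -> : l * (eps ^+ 2 * s ^+ 2) = s ^+ 2 * (l * eps ^+ 2) by ring.
  by rewrite ler_wpM2l ?sqr_ge0//; have := mulr_gt0 l0 e20; lra.
pose a := p / (2 - p).
have a0 : 0 < a by rewrite divr_gt0 ?subr_gt0.
pose v := w / (L / eps ^+ 2).
have v0 : 0 < v by rewrite !divr_gt0.
have bE : b / (2 * N) = v * s `^ (2 - p).
  rewrite powRB ?(gt_eqF s0) ?implybT// sN (powR_mulrn 2) ?(ltW s0)//.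
  by rewrite /b /v /w; field; rewrite !gt_eqF.
have baE : (b / (2 * N)) `^ a = v `^ a * N.
  rewrite bE (powRM _ (ltW v0) (powR_ge0 _ _)) -[(s `^ _) `^ a]powRrM.
  by rewrite /a mulrCA divff ?mulr1 ?sN// subr_eq0 gt_eqF.
(* Since [(1 - 2 / p) * a = - 1], the bound on [v] turns into one by [w] alone, free of [eps] and
   [p]. *)
have va : w^-1 <= v `^ a.
  have wv : w `^ (1 - 2 / p) <= v.
    rewrite ler_pdivlMr ?divr_gt0//.
    apply: le_trans (ler_wpM2l (powR_ge0 _ _) L_le) _.
    by rewrite -powRD ?subrK ?oner_eq0// powRr1// ltW.
  have -> : w^-1 = (w `^ (1 - 2 / p)) `^ a.
    rewrite -powRrM -powR_inv1 ?(ltW w0)//; congr (_ `^ _).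
    by rewrite /a; field; rewrite !gt_eqF// subr_gt0.
  by apply: ge0_ler_powR; rewrite ?nnegrE ?powR_ge0// ltW.
(* [516 * 128 / 242 < 273], whereas [k / 516 = 274 * l]: the surplus leaves an exponent of at most
   [- l], hence at most [- 2 L]. *)
pose E := (v `^ a * N * (516 * 128 * N)^-1)^-1.
have E_le : E <= 273 * l.
  have -> : E = 516 * 128 * (v `^ a)^-1.
    rewrite /E; have := powR_gt0 a v0; move: (v `^ a) => V V0.
    by field; rewrite !gt_eqF.
  apply: le_trans (_ : 516 * 128 * w <= _); last by rewrite /w; lra.
  by rewrite ler_pM2l ?mulr_gt0// -[leRHS]invrK lef_pV2 ?posrE ?powR_gt0 ?invr_gt0.
have tail := residual_tail k p1 p2 N0 b0.
apply: le_trans tail _; rewrite -/N -/a baE -/E.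
apply: le_trans (_ : expR (- 516^-1) ^+ k * expR (273 * l) <= _).
  rewrite ler_pM ?expR_ge0 ?exprn_ge0 ?divr_ge0 ?ler_expR//.
  rewrite lerXn2r ?nnegrE ?expR_ge0 ?divr_ge0//.
  by apply: le_trans (expR_ge1Dx _); lra.
by rewrite -expRM_natl -expRD ler_expR kE; lra.
Qed.

(** The two seeds are independent: average first over the Hutchinson vectors with the sketch fixed.
    A sketch with large residual is charged probability 1, any other the Hutchinson tail for
    [P A P]. *)
Lemma hutchpp_error n (A : 'M[R]_n) (p eps L : R) (k l : nat) :
  1 <= p <= 2 -> 0 < eps -> 0 < L ->
  242 * (Num.sqrt L / eps) `^ p <= l%:R -> 1024 * L <= l%:R ->
  k = (516 * (274 * l))%N ->
  mean (fun w : seed n k l =>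
    (eps * schatten_norm p A < `|\tr A - run A (hutchpp w)|)%R%:R) <=
  expR (- (2 * L)) + 2 * expR (- (3 * L)).
Proof.
move=> p12 e0 L0 Xl Ll kE.
(* With a zero norm the estimate must be exact; it is, because the residual [P *m A] then
   vanishes. *)
have [N0|N0] := leP (schatten_sum p A) 0.
  rewrite (@eq_mean _ _ _ (fun=> 0)) => [|w].
    rewrite mean_cst ?card_prod ?muln_gt0 ?card_sign_gt0//.
    by rewrite addr_ge0 ?mulr_ge0 ?expR_ge0.
  rewrite /hutchpp hutchpp_alg_error; set P := residual_proj _.
  have pP : is_proj P by exact/is_proj_foldl/is_proj_nil.
  suff -> : P *m A = 0.
    rewrite mul0mx mxtrace0 big1 => [|g _].
      by rewrite mulr0 subr0 normr0 ltNge mulr_ge0 ?powR_ge0// ltW.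
    by rewrite quadE mul0mx dotvE mulmx0 mxE.
  apply: frob2_eq0; apply/le_anti; rewrite frob2_ge0 andbT leNgt.
  by apply: contraTN N0 => /(schatten_sum_gt0 p12 pP); rewrite -ltNge.
set e := eps * _; have s0 : 0 < schatten_norm p A by exact: powR_gt0.
have ee0 : 0 < e by exact: mulr_gt0.
have kE' : k%:R = 516 * 274 * l%:R :> R by rewrite kE !natrM mulrA.
have fail := residual_fail p12 e0 L0 N0 Xl Ll kE'.
set b := l%:R * _ / _ in fail.
rewrite mean_pair.
have cardG := card_sign_gt0 n l.
apply: le_trans (_ : mean (fun S : 'M[bool]_(n, k) =>
  (b < residual A (gram_schmidt [seq A *m s | s <- sign_cols R S]))%R%:R +
   2 * expR (- (3 * L))) <= _); last by rewrite meanD mean_cst ?card_sign_gt0// lerD2r.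
apply: le_mean => S; case: (ltP b) => [_|rb].
  apply: le_trans (_ : 1 <= _); last by rewrite lerDl mulr_ge0 ?expR_ge0.
  rewrite -[leRHS](mean_cst (T := {: 'M[bool]_(n, l)}) 1 cardG).
  by apply: le_mean => G; case: (_ < _)%R; rewrite ?lexx ?ler01.
rewrite add0r.
have pP : is_proj (residual_proj (gram_schmidt [seq A *m s | s <- sign_cols R S])).
  exact/is_proj_foldl/is_proj_nil.
under eq_mean do rewrite /hutchpp hutchpp_alg_error size_sign_cols /=.
apply: hutchinson_tail => //.
move: rb; rewrite /b ler_pdivlMr ?mulr_gt0// mulrC; apply: le_trans.
by rewrite ler_wpM2l ?mulr_ge0 ?(ltW L0)// frob2_proj2_le.
Qed.

End HutchppError.

Theorem theoremB1 (R : realType) :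
  exists2 C : R, 0 < C &
  forall p : R, 1 <= p <= 2 ->
  exists k l : R -> R -> nat,
  forall eps delta : R, 0 < eps < 1 -> 0 < delta < 1 ->
  forall (n : nat) (A : 'M[R]_n),
    1 - delta <=
      uniform_prob R [pred w : seed n (k eps delta) (l eps delta) |
        `|\tr A - run A (hutchpp w)| <= eps * schatten_norm p A]
    /\
    forall w : seed n (k eps delta) (l eps delta),
      let L := ln (Num.min delta 2^-1)^-1 in
      (nqueries A (hutchpp w))%:R <= C * ((Num.sqrt L / eps) `^ p + L).
Proof.
(* The cost is at most [2 k + l = (2 * 516 * 274 + 1) * l], and [l] is at most
   [242 Y + 1024 L + 1 <= 1026 (Y + L)], with [Y] the power term and [1 <= 2 L]. *)
exists (2 * 516 * 274 * 1026 + 1026); first by rewrite addr_gt0 ?mulr_gt0.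
move=> p p12.
pose L (delta : R) := ln (Num.min delta 2^-1)^-1.
pose X (eps delta : R) := 242 * (Num.sqrt (L delta) / eps) `^ p + 1024 * L delta.
pose l eps delta := (Num.truncn (X eps delta)).+1.
exists (fun eps delta => 516 * (274 * l eps delta))%N, l.
move=> eps delta /andP[e0 e1] /andP[d0 d1] n A.
set D := Num.min delta 2^-1.
have D0 : 0 < D by rewrite /D lt_min d0 invr_gt0 ltr0n.
have Dd : D <= delta by rewrite /D ge_min lexx.
have D2 : D <= 2^-1 by rewrite /D ge_min lexx orbT.
have LD : expR (- L delta) = D.
  by rewrite /L -/D lnV ?posrE// opprK lnK ?posrE.
(* The cap of [delta] at [1/2] keeps [L] away from 0 for [delta] near 1, so that it absorbs the
   rounding of [l]. *)
have L_ge : 2^-1 <= L delta.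
  have : expR (- L delta) <= expR (- 2^-1).
    by rewrite LD; apply: le_trans D2 _; apply: le_trans (expR_ge1Dx _); lra.
  by rewrite ler_expR lerN2.
have X0 : 0 <= X eps delta.
  by rewrite addr_ge0 ?mulr_ge0 ?powR_ge0//; lra.
have Xl : X eps delta <= (l eps delta)%:R by rewrite ltW// truncnS_gt.
have lX : (l eps delta)%:R <= X eps delta + 1.
  by rewrite /l -natr1 lerD2r truncn_le.
have P0 := powR_ge0 (Num.sqrt (L delta) / eps) p.
split; last first.
  move=> w; rewrite -/(L delta); set Y := _ `^ p in P0 *.
  apply: le_trans (_ : (2 * (516 * (274 * l eps delta)) + l eps delta)%N%:R <= _).
    rewrite ler_nat.
    have := nqueries_hutchpp_alg A (sign_cols R w.1) (sign_cols R w.2).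
    by rewrite !size_sign_cols.
  by rewrite natrD !natrM; move: lX; rewrite /X -/Y; lra.
have [Xl1 Xl2] : 242 * (Num.sqrt (L delta) / eps) `^ p <= (l eps delta)%:R /\
    1024 * L delta <= (l eps delta)%:R by move: Xl; rewrite /X; split; lra.
have L0 : 0 < L delta by lra.
have := hutchpp_error A p12 e0 L0 Xl1 Xl2 (erefl _).
set q := mean _ => q_le; rewrite uniform_prob_mean.
have -> : mean (fun w : seed n (516 * (274 * l eps delta)) (l eps delta) =>
    ([pred w : seed n _ _ |
      `|\tr A - run A (hutchpp w)| <= eps * schatten_norm p A] w)%:R) = 1 - q.
  apply/eqP; rewrite eq_sym subr_eq -meanD; apply/eqP; symmetry.
  rewrite -[RHS](@mean_cst R (seed n (516 * (274 * l eps delta)) (l eps delta)) 1).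
    by apply: eq_mean => w /=; case: leP => _; rewrite ?addr0 ?add0r.
  by rewrite card_prod muln_gt0 !card_sign_gt0.
have E2 : expR (- (2 * L delta)) = D ^+ 2.
  by rewrite -LD -expRM_natl; congr expR; lra.
have E3 : expR (- (3 * L delta)) = D ^+ 3.
  by rewrite -LD -expRM_natl; congr expR; lra.
rewrite E2 E3 in q_le.
rewrite lerD2l lerN2; apply: le_trans q_le _; apply: le_trans Dd.
(* [D^2 + 2 D^3 <= D] because [D <= 1/2]. *)
by nra.
Qed.
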